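(* Consider the planar real systems $$\text{(I)}\quad \dot x = a_{10}x+a_{01}y,\qquad \dot y = b_{10}x+b_{01}y,$$ and, for an integer $t_2>1$, $$\text{(II)}\quad \dot x = a_{10}x,\qquad \dot y = b_{t_2 0}\,x^{t_2}+b_{01}y,$$ where all coefficients are real. Then: 1. The origin of system (II) is non-monodromic. 2. The origin of system (I) is monodromic if and only if $(b_{01}-a_{10})^2+4b_{10}a_{01}<0$, and in this case it is a center if and only if $a_{10}=-b_{01}$. 3. If the origin of system (I) is a center, then system (I) is reversible and analytically integrable.
   Context: System (I) is the general quasi-homogeneous polynomial system of degree $0$ of type $\mathbf t=(1,1)$, and (II) that of type $\mathbf t=(1,t_2)$, where $\dot{\mathbf x}=(P,Q)^T$ is quasi-homogeneous of type $(t_1,t_2)$ and degree $r$ if $P(\varepsilon^{t_1}x,\varepsilon^{t_2}y)=\varepsilon^{r+t_1}P(x,y)$ and $Q(\varepsilon^{t_1}x,\varepsilon^{t_2}y)=\varepsilon^{r+t_2}Q(x,y)$. A singular point is a center if it has a punctured neighborhood filled with periodic orbits surrounding it; it is a focus if the orbits in a punctured neighborhood spiral towards it in forward time or in backward time. It is monodromic if the orbits rotate around it; for analytic systems this means that it is a center or a focus. A vector field $\mathbf F$ is reversible if there is an analytic map $\sigma:U_0\subset\mathbb R^2\to\mathbb R^2$ on a neighborhood $U_0$ of the origin with $\sigma\circ\sigma=\mathrm{Id}$, $\sigma(0)=0$, $\sigma\neq\pm\mathrm{Id}$, such that $\sigma^*\mathbf F=-\mathbf F$, where $\sigma^*\mathbf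 F=(D\sigma)^{-1}\,\mathbf F\circ\sigma$ is the pull-back. A system is analytically integrable if it has an analytic (non-constant) first integral in a neighborhood of the origin, i.e. a function constant along the trajectories. *)

(* Defs.v *)
From Stdlib Require Export Reals.
From Coquelicot Require Export Coquelicot.
Open Scope R_scope.

Notation plane := (R * R)%type.

Definition origin : plane := (0, 0).

Definition system_I (a10 a01 b10 b01 : R) (p : plane) : plane :=
  (a10 * fst p + a01 * snd p, b10 * fst p + b01 * snd p).

Definition system_II (a10 bt b01 : R) (t2 : nat) (p : plane) : plane :=
  (a10 * fst p, bt * fst p ^ t2 + b01 * snd p).

Definition solution_on (F : plane -> plane) (D : R -> Prop) (gamma : R -> plane)
  : Prop :=
  forall t : R, D t -> is_derive gamma t (F (gamma t)).

(* A continuous determination of the polar angle along [gamma]; in particular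
   [gamma] does not meet the origin on [D]. *)
Definition polar_angle (gamma : R -> plane) (D : R -> Prop) (theta : R -> R)
  : Prop :=
  forall t : R, D t ->
    continuous theta t /\
    exists r : R, 0 < r /\ gamma t = (r * cos (theta t), r * sin (theta t)).

(* A closed orbit surrounds the origin when its winding number about the
   origin, (theta (t + T) - theta t) / (2 * PI), is not zero. *)
Definition periodic_around_origin (F : plane -> plane) (gamma : R -> plane)
  : Prop :=
  solution_on F (fun _ => True) gamma /\
  exists (T : R) (theta : R -> R),
    0 < T /\
    (forall t : R, gamma (t + T) = gamma t) /\
    polar_angle gamma (fun _ => True) theta /\
    theta T <> theta 0.

Definition center (F : plane -> plane) : Prop :=
  F origin = origin /\
  locally' origin (fun p : plane =>
    exists gamma : R -> plane, gamma 0 = p /\ periodic_around_origin F gamma).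

(* The derivative at time 0 is two-sided; this is no restriction, a solution
   on [0, +oo) being extendable to slightly negative times. *)
Definition spirals_to_origin (F : plane -> plane) (p : plane) : Prop :=
  exists (gamma : R -> plane) (theta : R -> R),
    gamma 0 = p /\
    solution_on F (fun t => 0 <= t) gamma /\
    filterlim gamma (Rbar_locally p_infty) (locally origin) /\
    polar_angle gamma (fun t => 0 <= t) theta /\
    (is_lim theta p_infty p_infty \/ is_lim theta p_infty m_infty).

Definition time_reversed (F : plane -> plane) (p : plane) : plane := opp (F p).

Definition focus (F : plane -> plane) : Prop :=
  F origin = origin /\
  (locally' origin (spirals_to_origin F) \/
   locally' origin (spirals_to_origin (time_reversed F))).

(* For analytic vector fields, the orbits rotate around a singular point
   exactly when it is a center or a focus. *)
Definition monodromic (F : plane -> plane) : Prop := center F \/ focus F.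

(* [f] is, near [p], the sum of an absolutely convergent double power series,
   whose terms are grouped by total degree. *)
Definition analytic_at (f : plane -> R) (p : plane) : Prop :=
  exists (c : nat -> nat -> R) (rho : R), 0 < rho /\
  forall u v : R, Rabs u < rho -> Rabs v < rho ->
    ex_series (fun n =>
      sum_n (fun k => Rabs (c k (n - k)%nat * u ^ k * v ^ (n - k))) n) /\
    is_series (fun n =>
      sum_n (fun k => c k (n - k)%nat * u ^ k * v ^ (n - k)) n)
      (f (fst p + u, snd p + v)).

Definition analytic_map_at (sigma : plane -> plane) (p : plane) : Prop :=
  analytic_at (fun q => fst (sigma q)) p /\ analytic_at (fun q => snd (sigma q)) p.

(* (D sigma)^{-1} (F o sigma), with the inverse of the Jacobian matrix
   ((s11, s12), (s21, s22)) written out.  The Jacobian determinant does not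
   vanish when sigma is a differentiable involution. *)
Definition pull_back (sigma F : plane -> plane) (p : plane) : plane :=
  let (x, y) := p in
  let s11 := Derive (fun u => fst (sigma (u, y))) x in
  let s12 := Derive (fun v => fst (sigma (x, v))) y in
  let s21 := Derive (fun u => snd (sigma (u, y))) x in
  let s22 := Derive (fun v => snd (sigma (x, v))) y in
  let d := s11 * s22 - s12 * s21 in
  let (f, g) := F (sigma p) in
  ((s22 * f - s12 * g) / d, (s11 * g - s21 * f) / d).

(* [U0] is stable under [sigma], so that sigma o sigma makes sense on it.
   sigma <> Id and sigma <> - Id are meant for germs at the origin: on a
   disconnected [U0] a mere inequality of functions would be weaker. *)
Definition reversible (F : plane -> plane) : Prop :=
  exists (U0 : plane -> Prop) (sigma : plane -> plane),
    open U0 /\ U0 origin /\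
    (forall p : plane, U0 p -> analytic_map_at sigma p) /\
    (forall p : plane, U0 p -> U0 (sigma p) /\ sigma (sigma p) = p) /\
    sigma origin = origin /\
    ~ locally origin (fun p : plane => sigma p = p) /\
    ~ locally origin (fun p : plane => sigma p = opp p) /\
    (forall p : plane, U0 p -> pull_back sigma F p = opp (F p)).

Definition first_integral (F : plane -> plane) (U : plane -> Prop)
  (H : plane -> R) : Prop :=
  forall (gamma : R -> plane) (a b : R),
    solution_on F (fun t => a < t < b) gamma ->
    (forall t : R, a < t < b -> U (gamma t)) ->
    forall s t : R, a < s < b -> a < t < b -> H (gamma s) = H (gamma t).

(* Non-constancy is likewise that of the germ of [H] at the origin. *)
Definition analytically_integrable (F : plane -> plane) : Prop :=
  exists (U : plane -> Prop) (H : plane -> R),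
    open U /\ U origin /\
    (forall p : plane, U p -> analytic_at H p) /\
    ~ locally origin (fun p : plane => H p = H origin) /\
    first_integral F U H.

(* Main.v *)
Require Import Defs.
From Stdlib Require Import Reals Ranalysis5 Lra Lia Psatz.
From Coquelicot Require Import Coquelicot.

(** Everything turns on the sign of the discriminant
    delta = (b01 - a10)^2 + 4 b10 a01 of the characteristic polynomial.

    When delta >= 0 the linear field has a real left eigenvector, that is, a
    linear form l with l (F p) = lambda (l p).  Along a solution l varies
    exponentially, so the line l = 0 is invariant: a solution starting on it
    never leaves it, its polar angle is frozen, and it neither surrounds the
    origin nor spirals.  Such a line has points arbitrarily close to the
    origin, hence the origin is not monodromic
    ([invariant_line_not_monodromic]).  System (II) is covered by the same
    lemma, its line being x = 0.

    When delta < 0 write the matrix as mu Id + N with N of trace zero; then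
    N^2 = - omega^2 Id with omega > 0, and the solution starting at p is
    exp (mu t) (cos (omega t) p + sin (omega t) / omega N p).  The quadratic
    form q p = det (p, N p) = det (p, F p) controls everything: it is
    definite, q divided by the squared norm is the angular velocity, and
    d/dt q = 2 mu q along solutions.
    - Definiteness gives an angular velocity bounded away from zero with a
      constant sign ([elliptic_flow_turns]), so every solution turns for
      ever.  If mu = 0 they are periodic and the origin is a center
      ([elliptic_center]); if mu < 0 they tend to the origin, which is a
      focus, and mu > 0 is mu < 0 with time reversed ([elliptic_focus]).
    - A periodic solution forces exp (2 mu T) = 1, so a center has mu = 0,
      which is the condition a10 = - b01 ([center_traceless]).
    - If mu = 0 then q is a polynomial first integral
      ([traceless_integrable]), and a linear involution that anticommutes
      with N reverses the field ([traceless_reversible]). *)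

(** * Derivatives, limits and neighbourhoods of the origin *)

Lemma is_derive_fst (gamma : R -> plane) (t : R) (v : plane) :
  is_derive gamma t v -> is_derive (fun s => fst (gamma s)) t (fst v).
Proof.
  intros H.
  exact (filterdiff_comp' (V := prod_NormedModule _ R_NormedModule R_NormedModule)
    gamma fst t _ _ H (filterdiff_linear _ is_linear_fst)).
Qed.

Lemma is_derive_snd (gamma : R -> plane) (t : R) (v : plane) :
  is_derive gamma t v -> is_derive (fun s => snd (gamma s)) t (snd v).
Proof.
  intros H.
  exact (filterdiff_comp' (V := prod_NormedModule _ R_NormedModule R_NormedModule)
    gamma snd t _ _ H (filterdiff_linear _ is_linear_snd)).
Qed.

Lemma is_derive_pair (x y : R -> R) (t dx dy : R) :
  is_derive x t dx -> is_derive y t dy ->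
  is_derive (fun s => (x s, y s) : plane) t ((dx, dy) : plane).
Proof.
  intros Hx Hy.
  pose (V := prod_NormedModule R_AbsRing R_NormedModule R_NormedModule).
  assert (H : is_derive
    (fun s => plus (scal (x s) ((1, 0) : V)) (scal (y s) ((0, 1) : V))) t
    (plus (scal dx ((1, 0) : V)) (scal dy ((0, 1) : V)))).
  { apply @is_derive_plus; now apply @is_derive_scal_l. }
  assert (E : forall a b : R,
    plus (scal a ((1, 0) : V)) (scal b ((0, 1) : V)) = (a, b)).
  { intros a b. unfold plus, scal; simpl. unfold prod_plus, prod_scal; simpl.
    unfold plus, scal; simpl. unfold mult; simpl. f_equal; ring. }
  rewrite E in H.
  revert H. apply is_derive_ext. intros s. apply E.
Qed.

Lemma derive_zero_constant (f : R -> R) :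
  (forall t, is_derive f t 0) -> forall t, f t = f 0.
Proof.
  intros Hf t.
  destruct (Rtotal_order t 0) as [Ht | [-> | Ht]]; [| reflexivity | symmetry];
    apply (eq_is_derive (V := R_NormedModule)); auto.
Qed.

Lemma linear_growth (lambda : R) (h : R -> R) :
  (forall t, 0 <= t -> is_derive h t (lambda * h t)) ->
  forall t, 0 <= t -> h t = h 0 * exp (lambda * t).
Proof.
  intros Hh t [Ht | <-]; [| rewrite Rmult_0_r, exp_0; ring].
  assert (E : h 0 * exp (- lambda * 0) = h t * exp (- lambda * t)).
  { apply (eq_is_derive (fun s => h s * exp (- lambda * s))); [| exact Ht].
    intros s Hs. specialize (Hh s (proj1 Hs)).
    assert (He : is_derive (fun s => exp (- lambda * s)) s
      (- lambda * exp (- lambda * s))) by (auto_derive; [exact I | ring]).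
    evar_last; [exact (is_derive_mult h _ s _ _ Hh He Rmult_comm) |].
    unfold plus, mult, zero; simpl; ring. }
  rewrite Rmult_0_r, exp_0, Rmult_1_r in E. rewrite E, Rmult_assoc, <- exp_plus.
  replace (- lambda * t + lambda * t) with 0 by ring. rewrite exp_0; ring.
Qed.

Lemma is_lim_linear_growth (f : R -> R) (k m : R) :
  0 < m -> (forall t, 0 <= t -> k + m * t <= f t) -> is_lim f p_infty p_infty.
Proof.
  intros Hm Hf. apply is_lim_spec. intros M.
  exists (Rmax 0 ((M - k) / m)). intros t Ht.
  pose proof (Rmax_l 0 ((M - k) / m)) as H1. pose proof (Rmax_r 0 ((M - k) / m)) as H2.
  assert (Hq : m * ((M - k) / m) = M - k) by (field; lra).
  specialize (Hf t ltac:(lra)). nra.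
Qed.

(** A property that holds near the origin is exploited below at one point only;
    this supplies that point, in a prescribed direction. *)
Lemma nbhd_origin_meets_rays (P : plane -> Prop) (u v : R) :
  locally origin P -> exists s, 0 < s /\ P (s * u, s * v).
Proof.
  intros [eps H].
  pose proof (cond_pos eps) as He.
  pose proof (Rabs_pos u) as Hu. pose proof (Rabs_pos v) as Hv.
  set (k := 1 + Rabs u + Rabs v).
  assert (Hs : 0 < eps / k) by (apply Rdiv_lt_0_compat; unfold k; lra).
  assert (Hk : eps / k * k = eps) by (field; unfold k; lra).
  assert (Hball : forall w, Rabs w < k -> ball 0 eps (eps / k * w)).
  { intros w Hw. unfold ball; simpl.
    unfold AbsRing_ball, abs, minus, plus, opp; simpl.
    rewrite Ropp_0, Rplus_0_r, Rabs_mult, (Rabs_pos_eq (eps / k)) by lra.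
    apply Rlt_le_trans with (eps / k * k); [| lra].
    now apply Rmult_lt_compat_l. }
  exists (eps / k). split; [exact Hs |]. apply H.
  split; apply Hball; unfold k; lra.
Qed.

(** * Invariant lines exclude monodromy *)

(** If the angle moved at all, the intermediate value theorem would give two
    angles on the line whose difference e satisfies 0 < |e| < 1; then
    sin e <> 0, the two directions are independent, and no nonzero linear form
    vanishes on both. *)
Lemma angle_constant_on_line (theta : R -> R) (alpha beta : R) :
  (alpha <> 0 \/ beta <> 0) ->
  (forall t, 0 <= t -> continuous theta t) ->
  (forall t, 0 <= t -> alpha * cos (theta t) + beta * sin (theta t) = 0) ->
  forall t, 0 <= t -> theta t = theta 0.
Proof.
  intros Hab Hc Hl t Ht.
  destruct (Req_dec (theta t) (theta 0)) as [E | Hne]; [exact E | exfalso].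
  assert (Ht' : 0 < t) by (destruct Ht as [Ht | <-]; [exact Ht | now elim Hne]).
  (* an intermediate angle closer than PI to theta 0 *)
  set (d := theta t - theta 0).
  assert (Hd : d <> 0) by (unfold d; lra).
  set (e := d / (1 + Rabs d)).
  assert (Hpos : 0 < 1 + Rabs d) by (pose proof (Rabs_pos d); lra).
  assert (Hed : e * (1 + Rabs d) = d) by (unfold e; field; lra).
  assert (Hphi : exists s, 0 <= s /\ theta s = theta 0 + e).
  { assert (Hd2 : 0 < d * d) by nra.
    assert (Hed2 : e * d * (1 + Rabs d) = d * d) by (rewrite <- Hed at 3; ring).
    assert (Hed0 : 0 < e * d) by (apply Rmult_lt_reg_r with (1 + Rabs d); lra).
    pose proof (Rabs_pos_lt d Hd) as Habs.
    destruct (IVT_interv (fun s => (theta s - theta 0 - e) * d) 0 t) as [s [Hs E]].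
    - intros u Hu. apply continuity_pt_filterlim.
      apply (continuous_comp theta (fun x => (x - theta 0 - e) * d)).
      + apply Hc; lra.
      + apply @ex_derive_continuous. now auto_derive.
    - exact Ht'.
    - replace (_ * d) with (- (e * d)) by ring. lra.
    - fold d. replace ((d - e) * d) with (e * d * Rabs d) by lra.
      now apply Rmult_lt_0_compat.
    - exists s. split; [lra |].
      apply Rmult_integral in E. lra. }
  destruct Hphi as [s [Hs E]].
  pose proof (Hl 0 (Rle_refl 0)) as H0. pose proof (Hl s Hs) as H1.
  rewrite E in H1.
  assert (Hsin : sin e <> 0).
  { pose proof PI2_1. destruct (Rlt_or_le 0 d) as [H' | H'].
    - rewrite Rabs_pos_eq in Hed, Hpos by lra.
      apply Rgt_not_eq, sin_gt_0; nra.
    - rewrite Rabs_left1 in Hed, Hpos by lra.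
      assert (0 < sin (- e)) by (apply sin_gt_0; nra).
      rewrite sin_neg in *. lra. }
  rewrite cos_plus, sin_plus in H1.
  pose proof (sin2_cos2 (theta 0)) as Hsc. unfold Rsqr in Hsc.
  set (c0 := cos (theta 0)) in *. set (s0 := sin (theta 0)) in *.
  assert (H2 : sin e * (beta * c0 - alpha * s0) = 0).
  { replace (sin e * (beta * c0 - alpha * s0)) with
      ((alpha * (c0 * cos e - s0 * sin e) + beta * (s0 * cos e + c0 * sin e))
       - cos e * (alpha * c0 + beta * s0)) by ring.
    rewrite H0, H1. ring. }
  apply Rmult_integral in H2. destruct H2 as [H2 | H2]; [now apply Hsin |].
  assert (alpha * alpha + beta * beta = 0).
  { replace (alpha * alpha + beta * beta) with
      ((alpha * alpha + beta * beta) * (s0 * s0 + c0 * c0)) by (rewrite Hsc; ring).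
    replace (_ * _) with ((alpha * c0 + beta * s0) ^ 2 + (beta * c0 - alpha * s0) ^ 2) by ring.
    rewrite H0, H2. ring. }
  destruct Hab; nra.
Qed.

(** The form vanishes at time 0 and satisfies a scalar linear equation along
    the solution, so it keeps vanishing.  Only nonnegative times occur, so that
    the lemma serves periodic solutions and spirals alike. *)
Lemma invariant_line_freezes_angle (F : plane -> plane) (alpha beta lambda : R)
    (D : R -> Prop) (gamma : R -> plane) (theta : R -> R) :
  (alpha <> 0 \/ beta <> 0) ->
  (forall p, alpha * fst (F p) + beta * snd (F p)
             = lambda * (alpha * fst p + beta * snd p)) ->
  (forall t, 0 <= t -> D t) ->
  solution_on F D gamma -> polar_angle gamma D theta ->
  alpha * fst (gamma 0) + beta * snd (gamma 0) = 0 ->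
  forall t, 0 <= t -> theta t = theta 0.
Proof.
  intros Hab HF HD Hsol Hpol H0.
  apply (angle_constant_on_line theta alpha beta); [exact Hab | |].
  - intros t Ht. apply (Hpol t (HD t Ht)).
  - intros t Ht.
    assert (Hl : alpha * fst (gamma t) + beta * snd (gamma t) = 0).
    { rewrite (linear_growth lambda
        (fun s => alpha * fst (gamma s) + beta * snd (gamma s))); [| | exact Ht].
      - rewrite H0. ring.
      - intros s Hs. rewrite <- HF.
        apply (is_derive_plus (V := R_NormedModule)
          (fun s => alpha * fst (gamma s)) (fun s => beta * snd (gamma s)));
          apply is_derive_scal;
          [apply is_derive_fst | apply is_derive_snd]; exact (Hsol s (HD s Hs)). }
    destruct (Hpol t (HD t Ht)) as [_ [r [Hr E]]].
    rewrite E in Hl; simpl in Hl.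
    apply Rmult_eq_reg_l with r; [| lra]. rewrite Rmult_0_r, <- Hl. ring.
Qed.

Lemma limit_of_frozen_angle (theta : R -> R) (l : Rbar) :
  (forall t, 0 <= t -> theta t = theta 0) -> is_lim theta p_infty l ->
  l = Finite (theta 0).
Proof.
  intros Hc Hl.
  rewrite <- (is_lim_unique _ _ _ Hl). apply is_lim_unique.
  apply is_lim_ext_loc with (fun _ => theta 0); [| apply is_lim_const].
  exists 0. intros t Ht. symmetry. apply Hc; lra.
Qed.

Lemma invariant_line_no_spirals (F : plane -> plane) (alpha beta lambda : R) :
  (alpha <> 0 \/ beta <> 0) ->
  (forall p, alpha * fst (F p) + beta * snd (F p)
             = lambda * (alpha * fst p + beta * snd p)) ->
  ~ locally' origin (spirals_to_origin F).
Proof.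
  intros Hab HF H.
  destruct (nbhd_origin_meets_rays _ beta (- alpha) H) as [s [Hs Hp]].
  destruct Hp as [gamma [theta [E0 [Hsol [_ [Hpol Hlim]]]]]].
  { unfold origin. intros E; injection E as E1 E2. destruct Hab; nra. }
  assert (Hc := invariant_line_freezes_angle F alpha beta lambda _ gamma theta
    Hab HF (fun t Ht => Ht) Hsol Hpol).
  rewrite E0 in Hc; simpl in Hc.
  destruct Hlim as [Hlim | Hlim]; apply limit_of_frozen_angle in Hlim;
    try discriminate; apply Hc; ring.
Qed.

(** A line invariant for a field is invariant for the time-reversed field,
    with the opposite eigenvalue. *)
Lemma invariant_line_not_monodromic (F : plane -> plane) (alpha beta lambda : R) :
  (alpha <> 0 \/ beta <> 0) ->
  (forall p, alpha * fst (F p) + beta * snd (F p)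
             = lambda * (alpha * fst p + beta * snd p)) ->
  ~ monodromic F.
Proof.
  intros Hab HF [[_ H] | [_ [H | H]]].
  - destruct (nbhd_origin_meets_rays _ beta (- alpha) H) as [s [Hs Hp]].
    destruct Hp as [gamma [E0 [Hsol [T [theta [HT [_ [Hpol Hne]]]]]]]].
    { unfold origin. intros E; injection E as E1 E2. destruct Hab; nra. }
    apply Hne.
    apply (invariant_line_freezes_angle F alpha beta lambda _ gamma theta
      Hab HF (fun _ _ => I) Hsol Hpol); [| lra].
    rewrite E0; simpl; ring.
  - exact (invariant_line_no_spirals F alpha beta lambda Hab HF H).
  - apply (invariant_line_no_spirals (time_reversed F) alpha beta (- lambda) Hab);
      [| exact H].
    intros p. unfold time_reversed, opp; simpl. unfold prod_opp, opp; simpl.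
    specialize (HF p). lra.
Qed.

(** With lambda the larger eigenvalue, (c, lambda - a) is a left eigenvector
    unless c = 0, in which case y already satisfies an equation of its own. *)
Lemma system_I_invariant_line (a b c d : R) :
  0 <= (d - a) ^ 2 + 4 * c * b ->
  exists alpha beta lambda, (alpha <> 0 \/ beta <> 0) /\
    forall p, alpha * fst (system_I a b c d p) + beta * snd (system_I a b c d p)
      = lambda * (alpha * fst p + beta * snd p).
Proof.
  intros Hdisc. destruct (Req_dec c 0) as [-> | Hc].
  - exists 0, 1, d. split; [right; lra |]. intros p; simpl; ring.
  - set (s := sqrt ((d - a) ^ 2 + 4 * c * b)).
    assert (Hs : s * s = (d - a) ^ 2 + 4 * c * b) by now apply sqrt_sqrt.
    exists c, ((d - a + s) / 2), ((a + d + s) / 2). split; [now left |].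
    intros [x y]; simpl.
    assert (E : c * b = (s * s - (d - a) ^ 2) / 4) by (rewrite Hs; field).
    transitivity (c * a * x + (c * b) * y + (d - a + s) / 2 * (c * x + d * y)); [ring |].
    rewrite E. field.
Qed.

(** * Lifting a plane curve to polar coordinates *)

Lemma polar_coordinates (x y : R) :
  0 < x ^ 2 + y ^ 2 -> exists phi,
    x = sqrt (x ^ 2 + y ^ 2) * cos phi /\ y = sqrt (x ^ 2 + y ^ 2) * sin phi.
Proof.
  intros Hp.
  set (r := sqrt (x ^ 2 + y ^ 2)).
  assert (Hr : 0 < r) by now apply sqrt_lt_R0.
  assert (Er : r * r = x ^ 2 + y ^ 2) by (apply sqrt_sqrt; now apply Rlt_le).
  set (k := x / r).
  assert (Ek : x = r * k) by (unfold k; field; lra).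
  assert (Hk : -1 <= k <= 1).
  { assert (0 <= 1 - k * k) by (apply Rmult_le_reg_l with (r * r); nra).
    split; nra. }
  assert (Es : r * sqrt (1 - Rsqr k) = Rabs y).
  { rewrite <- (sqrt_Rsqr r) at 1 by lra. rewrite <- sqrt_mult_alt by apply Rle_0_sqr.
    rewrite <- sqrt_Rsqr_abs. f_equal. unfold Rsqr in *.
    replace (r * r * (1 - k * k)) with (r * r - (r * k) * (r * k)) by ring.
    rewrite <- Ek, Er. ring. }
  destruct (Rle_or_lt 0 y) as [Hy | Hy].
  - exists (acos k). rewrite cos_acos, sin_acos, Es, Rabs_pos_eq by assumption.
    now split.
  - exists (- acos k). rewrite cos_neg, sin_neg, cos_acos, sin_acos by assumption.
    split; [exact Ek |]. rewrite Rabs_left in Es by exact Hy. lra.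
Qed.

(** The angle is obtained by integrating the angular velocity w from a polar
    angle phi of the initial point.  To see that it is a polar angle at all
    times, compare the unit vector of the curve with the direction theta: both
    turn with velocity w, so the angle between them never changes. *)
Lemma polar_angle_lift (x y dx dy : R -> R) :
  (forall t, is_derive x t (dx t)) -> (forall t, is_derive y t (dy t)) ->
  (forall t, continuous dx t) -> (forall t, continuous dy t) ->
  (forall t, 0 < x t ^ 2 + y t ^ 2) ->
  exists theta : R -> R,
    (forall t, is_derive theta t
       ((x t * dy t - y t * dx t) / (x t ^ 2 + y t ^ 2))) /\
    polar_angle (fun t => (x t, y t)) (fun _ => True) theta.
Proof.
  intros Hx Hy Hc1 Hc2 Hpos.
  pose (w := fun t => (x t * dy t - y t * dx t) / (x t ^ 2 + y t ^ 2)).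
  assert (Hcx : forall t, continuous x t)
    by (intros t; apply @ex_derive_continuous; eexists; apply Hx).
  assert (Hcy : forall t, continuous y t)
    by (intros t; apply @ex_derive_continuous; eexists; apply Hy).
  assert (Hcw : forall t, continuous w t).
  { intros t. unfold w, Rdiv.
    apply (continuous_mult (K := R_AbsRing)
      (fun s => x s * dy s - y s * dx s) (fun s => / (x s ^ 2 + y s ^ 2))).
    - apply (continuous_minus (V := R_NormedModule)
        (fun s => x s * dy s) (fun s => y s * dx s));
        apply (continuous_mult (K := R_AbsRing)); auto.
    - apply (continuous_comp (fun s => x s ^ 2 + y s ^ 2) Rinv).
      + apply @ex_derive_continuous. eexists.
        apply (is_derive_plus (V := R_NormedModule)
          (fun s => x s ^ 2) (fun s => y s ^ 2)); apply is_derive_pow; auto.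
      + apply @ex_derive_continuous. auto_derive. now apply Rgt_not_eq, Hpos. }
  destruct (polar_coordinates (x 0) (y 0) (Hpos 0)) as [phi [Ex Ey]].
  pose (theta := fun t => phi + RInt w 0 t).
  assert (Hth : forall t, is_derive theta t (w t)).
  { intros t. unfold theta.
    evar_last.
    - apply (is_derive_plus (V := R_NormedModule) (fun _ => phi) (fun t => RInt w 0 t)).
      + apply @is_derive_const.
      + apply is_derive_RInt with (a := 0); [| apply Hcw].
        apply filter_forall. intros s. apply @RInt_correct.
        apply @ex_RInt_continuous. intros z _. apply Hcw.
    - unfold plus, zero; simpl. ring. }
  assert (Hth0 : theta 0 = phi).
  { unfold theta. rewrite RInt_point. unfold zero; simpl. ring. }
  clearbody theta. exists theta. split; [exact Hth |].
  (* logarithmic derivative of the distance to the origin *)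
  pose (kappa := fun t => (x t * dx t + y t * dy t) / (x t ^ 2 + y t ^ 2)).
  pose (N := fun t => / sqrt (x t ^ 2 + y t ^ 2)).
  assert (Hsq : forall t, 0 < sqrt (x t ^ 2 + y t ^ 2))
    by (intros t; apply sqrt_lt_R0, Hpos).
  assert (HN : forall t, is_derive N t (- kappa t * N t)).
  { intros t.
    assert (H1 : is_derive (fun s => x s ^ 2 + y s ^ 2) t
                  (2 * (x t * dx t + y t * dy t))).
    { evar_last.
      - apply (is_derive_plus (V := R_NormedModule)
          (fun s => x s ^ 2) (fun s => y s ^ 2)); apply is_derive_pow; auto.
      - unfold plus; simpl. ring. }
    evar_last.
    - apply is_derive_inv; [apply (is_derive_sqrt _ _ _ H1), Hpos |].
      apply Rgt_not_eq, Hsq.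
    - unfold kappa, N. specialize (Hsq t).
      rewrite <- (pow2_sqrt (x t ^ 2 + y t ^ 2)) at 3 by apply Rlt_le, Hpos.
      field. now apply Rgt_not_eq. }
  assert (HN1 : forall s, sqrt (x s ^ 2 + y s ^ 2) * N s = 1)
    by (intros s; apply Rinv_r, Rgt_not_eq, Hsq).
  clearbody N.
  (* cosine of the angle between the curve and the direction theta + psi,
     which does not change in time *)
  assert (Hrot : forall psi t,
    (x t * cos (theta t + psi) + y t * sin (theta t + psi)) * N t = cos psi).
  { intros psi t.
    rewrite (derive_zero_constant (fun s =>
      (x s * cos (theta s + psi) + y s * sin (theta s + psi)) * N s)).
    - pose proof (HN1 0) as H1. revert H1 Ex Ey.
      generalize (sqrt (x 0 ^ 2 + y 0 ^ 2)). intros r H1 Ex Ey.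
      rewrite Hth0, Ex, Ey.
      transitivity (r * N 0 * cos (phi + psi - phi)).
      + rewrite cos_minus. ring.
      + rewrite H1, Rmult_1_l. f_equal; ring.
    - clear t. intros t. auto_derive.
      + repeat split; eexists; eauto.
      + rewrite (is_derive_unique (fun u : R => x u) t _ (Hx t)),
          (is_derive_unique (fun u : R => y u) t _ (Hy t)),
          (is_derive_unique (fun u : R => theta u) t _ (Hth t)),
          (is_derive_unique (fun u : R => N u) t _ (HN t)).
        unfold kappa, w. field. apply Rgt_not_eq, Hpos. }
  intros t _. split; [apply @ex_derive_continuous; eexists; apply Hth |].
  exists (sqrt (x t ^ 2 + y t ^ 2)). split; [apply Hsq |].
  (* the choices of psi that turn theta + psi into 0 and PI / 2 *)
  pose proof (Hrot (- theta t) t) as HX.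
  pose proof (Hrot (PI / 2 - theta t) t) as HY.
  rewrite Rplus_opp_r, cos_0, sin_0, cos_neg in HX.
  replace (theta t + (PI / 2 - theta t)) with (PI / 2) in HY by ring.
  rewrite cos_PI2, sin_PI2, cos_shift in HY.
  rewrite <- HX, <- HY.
  f_equal; [transitivity (x t * (sqrt (x t ^ 2 + y t ^ 2) * N t))
           | transitivity (y t * (sqrt (x t ^ 2 + y t ^ 2) * N t))];
    solve [rewrite HN1; ring | ring].
Qed.

(** * The areal quadratic form *)

(** The form det (p, N p) for the matrix N with rows (n, b) and (c, - n). *)
Definition areal_form (n b c : R) (p : plane) : R :=
  c * fst p ^ 2 - 2 * n * fst p * snd p - b * snd p ^ 2.

Definition sqnorm (p : plane) : R := fst p ^ 2 + snd p ^ 2.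

Lemma sqnorm_pos (p : plane) : p <> origin -> 0 < sqnorm p.
Proof.
  destruct p as [x y]; unfold sqnorm, origin; simpl. intros Hp.
  destruct (Req_dec x 0) as [-> | Hx]; [| nra].
  destruct (Req_dec y 0) as [-> | Hy]; [now elim Hp | nra].
Qed.

(** Completing squares: if A X^2 + 2 B X Y + C Y^2 has A C - B^2 = omega^2,
    then (A + C) times it exceeds omega^2 (X^2 + Y^2) by the two squares
    (A X + B Y)^2 and (B X + C Y)^2.  Here (A, B, C) = (c, - n, - b) and
    A + C = c - b, whose sign decides between the two cases. *)
Lemma areal_definite (n b c omega : R) :
  0 < omega -> n ^ 2 + b * c = - omega ^ 2 ->
  exists m, 0 < m /\
    ((forall p, m * sqnorm p <= areal_form n b c p) \/
     (forall p, areal_form n b c p <= - (m * sqnorm p))).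
Proof.
  intros Hom E.
  assert (Hbc : b * c < 0) by nra.
  assert (Hid : forall p, (c - b) * areal_form n b c p
    = omega ^ 2 * sqnorm p + (c * fst p - n * snd p) ^ 2 + (n * fst p + b * snd p) ^ 2).
  { intros [x y]. replace (omega ^ 2) with (- (n ^ 2 + b * c)) by (rewrite E; ring).
    unfold areal_form, sqnorm; simpl. ring. }
  destruct (Rlt_or_le 0 c) as [Hc | Hc].
  - assert (0 < c - b) by nra.
    exists (omega ^ 2 / (c - b)). split; [apply Rdiv_lt_0_compat; nra |]. left. intros p.
    apply Rmult_le_reg_l with (c - b); [assumption |]. rewrite Hid.
    replace ((c - b) * (omega ^ 2 / (c - b) * sqnorm p)) with (omega ^ 2 * sqnorm p)
      by (field; lra).
    pose proof (pow2_ge_0 (c * fst p - n * snd p)).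
    pose proof (pow2_ge_0 (n * fst p + b * snd p)). lra.
  - assert (0 < b - c) by nra.
    exists (omega ^ 2 / (b - c)). split; [apply Rdiv_lt_0_compat; nra |]. right. intros p.
    apply Rmult_le_reg_l with (b - c); [assumption |].
    replace ((b - c) * areal_form n b c p) with (- ((c - b) * areal_form n b c p)) by ring.
    rewrite Hid.
    replace ((b - c) * - (omega ^ 2 / (b - c) * sqnorm p)) with (- (omega ^ 2 * sqnorm p))
      by (field; lra).
    pose proof (pow2_ge_0 (c * fst p - n * snd p)).
    pose proof (pow2_ge_0 (n * fst p + b * snd p)). lra.
Qed.

(** Twice mu is the trace of the matrix: an area det (p, F p) transported by a
    linear flow is multiplied by the determinant of the flow, whose logarithmic
    derivative is the trace. *)
Lemma areal_derive (mu n b c t : R) (gamma : R -> plane) :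
  is_derive gamma t (system_I (mu + n) b c (mu - n) (gamma t)) ->
  is_derive (fun s => areal_form n b c (gamma s)) t (2 * mu * areal_form n b c (gamma t)).
Proof.
  intros H.
  apply is_derive_fst in H as Hx. apply is_derive_snd in H as Hy.
  unfold areal_form. simpl fst in Hx; simpl snd in Hy.
  pose (x := fun s => fst (gamma s)). pose (y := fun s => snd (gamma s)).
  change (is_derive x t ((mu + n) * x t + b * y t)) in Hx.
  change (is_derive y t (c * x t + (mu - n) * y t)) in Hy.
  change (is_derive (fun s => c * x s ^ 2 - 2 * n * x s * y s - b * y s ^ 2) t
    (2 * mu * (c * x t ^ 2 - 2 * n * x t * y t - b * y t ^ 2))).
  clearbody x y. auto_derive.
  - repeat split; eexists; eassumption.
  - rewrite (is_derive_unique (fun u : R => x u) t _ Hx),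
      (is_derive_unique (fun u : R => y u) t _ Hy). ring.
Qed.

(** * The flow when the eigenvalues are not real *)

(** The trace-free splitting of the matrix; the discriminant is
    - 4 omega^2. *)
Lemma elliptic_normal_parameters (a b c d : R) :
  (d - a) ^ 2 + 4 * c * b < 0 ->
  exists mu n omega, 0 < omega /\ n ^ 2 + b * c = - omega ^ 2 /\
    a = mu + n /\ d = mu - n.
Proof.
  intros H. exists ((a + d) / 2), ((a - d) / 2), (sqrt (- ((d - a) ^ 2 + 4 * c * b)) / 2).
  split; [apply Rdiv_lt_0_compat; [apply sqrt_lt_R0 |]; lra |].
  split; [| split; field].
  unfold Rdiv. rewrite (Rpow_mult_distr (sqrt _)), pow2_sqrt by lra. field.
Qed.

(** The matrix exponential of t (mu Id + N) for N^2 = - omega^2 Id. *)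
Definition elliptic_flow (mu n b c omega : R) (p : plane) (t : R) : plane :=
  (exp (mu * t) * (cos (omega * t) * fst p
                   + sin (omega * t) / omega * (n * fst p + b * snd p)),
   exp (mu * t) * (cos (omega * t) * snd p
                   + sin (omega * t) / omega * (c * fst p - n * snd p))).

Lemma elliptic_flow_0 (mu n b c omega : R) (p : plane) :
  elliptic_flow mu n b c omega p 0 = p.
Proof.
  destruct p as [x y]; unfold elliptic_flow; simpl.
  rewrite !Rmult_0_r, exp_0, cos_0, sin_0. unfold Rdiv. f_equal; ring.
Qed.

Lemma elliptic_flow_solution (mu n b c omega : R) (p : plane) (t : R) :
  0 < omega -> n ^ 2 + b * c = - omega ^ 2 ->
  is_derive (elliptic_flow mu n b c omega p) t
    (system_I (mu + n) b c (mu - n) (elliptic_flow mu n b c omega p t)).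
Proof.
  intros Hom E. unfold elliptic_flow, system_I.
  apply is_derive_pair; auto_derive; trivial; simpl.
  - apply Rminus_diag_uniq.
    transitivity (- exp (mu * t) * (sin (omega * t) / omega) * fst p
                  * (omega ^ 2 + (n ^ 2 + b * c))); [field; lra | rewrite E; ring].
  - apply Rminus_diag_uniq.
    transitivity (- exp (mu * t) * (sin (omega * t) / omega) * snd p
                  * (omega ^ 2 + (n ^ 2 + b * c))); [field; lra | rewrite E; ring].
Qed.

(** Used with definiteness to see that the flow avoids the origin at every
    time, negative times included. *)
Lemma elliptic_flow_areal (mu n b c omega : R) (p : plane) (t : R) :
  0 < omega -> n ^ 2 + b * c = - omega ^ 2 ->
  areal_form n b c (elliptic_flow mu n b c omega p t)
  = exp (mu * t) ^ 2 * areal_form n b c p.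
Proof.
  intros Hom E.
  assert (H1 : cos (omega * t) ^ 2 - (n ^ 2 + b * c) * (sin (omega * t) / omega) ^ 2 = 1).
  { rewrite E. transitivity (Rsqr (sin (omega * t)) + Rsqr (cos (omega * t))).
    - unfold Rsqr; field; lra.
    - apply sin2_cos2. }
  transitivity (exp (mu * t) ^ 2 * areal_form n b c p *
    (cos (omega * t) ^ 2 - (n ^ 2 + b * c) * (sin (omega * t) / omega) ^ 2)).
  - unfold areal_form, elliptic_flow; simpl fst; simpl snd. ring.
  - rewrite H1. ring.
Qed.

(** The angular velocity is the areal form divided by the squared norm, so
    definiteness bounds it away from zero; the mean value theorem does the
    rest. *)
Lemma elliptic_flow_turns (mu n b c omega : R) (p : plane) :
  0 < omega -> n ^ 2 + b * c = - omega ^ 2 -> p <> origin ->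
  exists (theta : R -> R) (m : R), 0 < m /\
    polar_angle (elliptic_flow mu n b c omega p) (fun _ => True) theta /\
    ((forall t, 0 <= t -> theta 0 + m * t <= theta t) \/
     (forall t, 0 <= t -> theta t <= theta 0 - m * t)).
Proof.
  intros Hom E Hp.
  pose (F := system_I (mu + n) b c (mu - n)).
  pose (gamma := elliptic_flow mu n b c omega p). fold gamma.
  destruct (areal_definite n b c omega Hom E) as [m [Hm Hdef]].
  pose (x := fun t => fst (gamma t)). pose (y := fun t => snd (gamma t)).
  assert (Hx : forall t, is_derive x t (fst (F (gamma t))))
    by (intros t; now apply is_derive_fst, elliptic_flow_solution).
  assert (Hy : forall t, is_derive y t (snd (F (gamma t))))
    by (intros t; now apply is_derive_snd, elliptic_flow_solution).
  assert (Hpos : forall t, 0 < x t ^ 2 + y t ^ 2).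
  { intros t. apply (sqnorm_pos (gamma t)). intros E0.
    pose proof (elliptic_flow_areal mu n b c omega p t Hom E) as Ht.
    fold gamma in Ht. rewrite E0 in Ht.
    pose proof (exp_pos (mu * t)) as He. apply (pow_lt _ 2) in He.
    pose proof (sqnorm_pos p Hp) as Hsp.
    assert (Hnz : areal_form n b c p <> 0)
      by (destruct Hdef as [Hdef | Hdef]; specialize (Hdef p); nra).
    apply Hnz, (Rmult_eq_reg_l (exp (mu * t) ^ 2)); [| lra].
    rewrite <- Ht. unfold areal_form, origin; simpl. ring. }
  destruct (polar_angle_lift x y (fun t => fst (F (gamma t)))
    (fun t => snd (F (gamma t)))) as [theta [Hth Hpol]]; auto.
  { intros t. apply @ex_derive_continuous.
    unfold F, gamma, elliptic_flow, system_I; simpl. now auto_derive. }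
  { intros t. apply @ex_derive_continuous.
    unfold F, gamma, elliptic_flow, system_I; simpl. now auto_derive. }
  assert (Hth' : forall t, is_derive theta t (areal_form n b c (gamma t) / sqnorm (gamma t))).
  { intros t. evar_last; [apply Hth |]. unfold sqnorm. f_equal.
    unfold areal_form, F, system_I, x, y; simpl. ring. }
  assert (Hmvt : forall t, 0 < t -> exists s,
    theta t - theta 0 = areal_form n b c (gamma s) / sqnorm (gamma s) * (t - 0)).
  { intros t Ht.
    destruct (MVT_gen theta 0 t (fun s => areal_form n b c (gamma s) / sqnorm (gamma s)))
      as [s [_ Hs]].
    - intros s _. apply Hth'.
    - intros s _. apply continuity_pt_filterlim, (Hpol s I).
    - now exists s. }
  exists theta, m. split; [exact Hm |]. split.
  { intros t Ht. rewrite (surjective_pairing (gamma t)). exact (Hpol t Ht). }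
  destruct Hdef as [Hdef | Hdef]; [left | right];
    (intros t [Ht | <-]; [| lra]); destruct (Hmvt t Ht) as [s Hs];
    specialize (Hdef (gamma s)); specialize (Hpos s);
    change (0 < sqnorm (gamma s)) in Hpos.
  - assert (m <= areal_form n b c (gamma s) / sqnorm (gamma s))
      by (now apply Rle_div_r). nra.
  - assert (areal_form n b c (gamma s) / sqnorm (gamma s) <= - m)
      by (apply Rle_div_l; lra). nra.
Qed.

(** * Centers and foci *)

Lemma elliptic_center (n b c omega : R) :
  0 < omega -> n ^ 2 + b * c = - omega ^ 2 ->
  center (system_I (0 + n) b c (0 - n)).
Proof.
  intros Hom E. split.
  { unfold system_I, origin; simpl. f_equal; ring. }
  exists (mkposreal 1 Rlt_0_1). intros p _ Hp.
  pose proof PI_RGT_0 as HPI.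
  assert (HT : 0 < 2 * PI / omega) by (apply Rdiv_lt_0_compat; lra).
  destruct (elliptic_flow_turns 0 n b c omega p Hom E Hp)
    as [theta [m [Hm [Hpol Hturn]]]].
  exists (elliptic_flow 0 n b c omega p). split; [apply elliptic_flow_0 |].
  split; [intros t _; now apply elliptic_flow_solution |].
  exists (2 * PI / omega), theta. split; [exact HT |].
  split; [| split; [exact Hpol |]].
  - intros t. unfold elliptic_flow.
    replace (omega * (t + 2 * PI / omega)) with (omega * t + 2 * PI) by (field; lra).
    replace (0 * (t + 2 * PI / omega)) with (0 * t) by ring.
    rewrite <- (sin_period (omega * t) 1), <- (cos_period (omega * t) 1).
    simpl INR. now rewrite Rmult_1_r.
  - destruct Hturn as [H | H]; specialize (H (2 * PI / omega)); nra.
Qed.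

Lemma elliptic_spirals (mu n b c omega : R) (p : plane) :
  mu < 0 -> 0 < omega -> n ^ 2 + b * c = - omega ^ 2 -> p <> origin ->
  spirals_to_origin (system_I (mu + n) b c (mu - n)) p.
Proof.
  intros Hmu Hom E Hp.
  destruct (elliptic_flow_turns mu n b c omega p Hom E Hp)
    as [theta [m [Hm [Hpol Hturn]]]].
  exists (elliptic_flow mu n b c omega p), theta.
  split; [apply elliptic_flow_0 |].
  split; [intros t _; now apply elliptic_flow_solution |].
  split; [| split; [intros t _; now apply Hpol |]].
  - assert (Hexp : is_lim (fun t => exp (mu * t)) p_infty 0).
    { apply is_lim_comp with m_infty; [apply is_lim_exp_m | |].
      - apply is_lim_ext with (fun t => - (- mu * t)); [intros t; ring |].
        apply (is_lim_opp _ _ p_infty), (is_lim_linear_growth _ 0 (- mu)); [lra |].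
        intros t _. lra.
      - exists 0. discriminate. }
    (* the two coordinates of the flow have the same shape in (u, v) *)
    pose (K := fun u v => Rabs u + Rabs v / omega).
    assert (HK : forall u v t,
      Rabs (exp (mu * t) * (cos (omega * t) * u + sin (omega * t) / omega * v))
      <= exp (mu * t) * K u v).
    { intros u v t. rewrite Rabs_mult, (Rabs_pos_eq (exp _)) by apply Rlt_le, exp_pos.
      apply Rmult_le_compat_l; [apply Rlt_le, exp_pos |].
      eapply Rle_trans; [apply Rabs_triang |]. unfold K, Rdiv.
      rewrite !Rabs_mult, Rabs_inv, (Rabs_pos_eq omega) by lra.
      assert (Hc : Rabs (cos (omega * t)) <= 1) by apply Rabs_le, COS_bound.
      assert (Hs : Rabs (sin (omega * t)) <= 1) by apply Rabs_le, SIN_bound.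
      assert (Hv : 0 <= Rabs v * / omega)
        by (apply Rmult_le_pos; [apply Rabs_pos | now apply Rlt_le, Rinv_0_lt_compat]).
      pose proof (Rabs_pos u). nra. }
    assert (Hlim : forall u v (eps : posreal), Rbar_locally p_infty (fun t =>
      ball 0 eps (exp (mu * t) * (cos (omega * t) * u + sin (omega * t) / omega * v)))).
    { intros u v eps.
      assert (HL : is_lim (fun t => exp (mu * t) * K u v) p_infty 0).
      { replace (Finite 0) with (Rbar_mult 0 (K u v)) by (simpl; f_equal; ring).
        now apply is_lim_scal_r. }
      apply is_lim_spec in HL. destruct (HL eps) as [M HM].
      exists M. intros t Ht. specialize (HM t Ht). specialize (HK u v t).
      unfold ball; simpl. unfold AbsRing_ball, abs, minus, plus, opp; simpl.
      rewrite Ropp_0, Rplus_0_r.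
      rewrite Rminus_0_r in HM. apply Rabs_def2 in HM. lra. }
    apply filterlim_locally. intros eps.
    apply filter_and; apply Hlim.
  - destruct Hturn as [H | H]; [left | right].
    + now apply is_lim_linear_growth with (theta 0) m.
    + apply is_lim_ext with (fun t => - - theta t); [intros t; ring |].
      apply (is_lim_opp _ _ p_infty), (is_lim_linear_growth _ (- theta 0) m Hm).
      intros t Ht. specialize (H t Ht). lra.
Qed.

Lemma spirals_to_origin_ext (F G : plane -> plane) (p : plane) :
  (forall q, F q = G q) -> spirals_to_origin F p -> spirals_to_origin G p.
Proof.
  intros HFG [gamma [theta [H0 [Hsol H]]]].
  exists gamma, theta. split; [exact H0 |]. split; [| exact H].
  intros t Ht. rewrite <- HFG. now apply Hsol.
Qed.

Lemma elliptic_focus (mu n b c omega : R) :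
  mu <> 0 -> 0 < omega -> n ^ 2 + b * c = - omega ^ 2 ->
  focus (system_I (mu + n) b c (mu - n)).
Proof.
  intros Hmu Hom E. split.
  { unfold system_I, origin; simpl. f_equal; ring. }
  destruct (Rdichotomy _ _ Hmu) as [Hneg | Hpos]; [left | right];
    exists (mkposreal 1 Rlt_0_1); intros p _ Hp.
  - now apply elliptic_spirals with omega.
  - apply spirals_to_origin_ext with (system_I (- mu + - n) (- b) (- c) (- mu - - n)).
    + intros q. unfold time_reversed, system_I, opp; simpl.
      unfold prod_opp, opp; simpl. f_equal; ring.
    + apply elliptic_spirals with omega; [lra | assumption | | assumption].
      rewrite <- E. ring.
Qed.

(** Over a period the areal form is both unchanged and multiplied by
    exp (2 mu T); it does not vanish at the starting point, which is taken on
    the first axis. *)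
Lemma center_traceless (mu n b c omega : R) :
  0 < omega -> n ^ 2 + b * c = - omega ^ 2 ->
  center (system_I (mu + n) b c (mu - n)) -> mu = 0.
Proof.
  intros Hom E [_ H].
  destruct (nbhd_origin_meets_rays _ 1 0 H) as [s [Hs Hp]].
  destruct Hp as [gamma [E0 [Hsol [T [theta [HT [Hper _]]]]]]].
  { unfold origin. intros E'; injection E' as E1 E2. lra. }
  assert (Hg := linear_growth (2 * mu) (fun t => areal_form n b c (gamma t))
    (fun t _ => areal_derive mu n b c t gamma (Hsol t I)) T (Rlt_le _ _ HT)).
  cbv beta in Hg. rewrite <- (Rplus_0_l T), Hper in Hg at 1.
  rewrite E0 in Hg. unfold areal_form in Hg; simpl in Hg.
  assert (Hc : c <> 0) by (intros ->; nra).
  assert (He : exp (2 * mu * T) = exp 0).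
  { rewrite exp_0. apply Rmult_eq_reg_l with (c * (s * s)).
    - etransitivity; [| etransitivity; [symmetry; exact Hg |]]; ring.
    - apply Rmult_integral_contrapositive; split; [exact Hc | nra]. }
  apply exp_inv in He.
  apply Rmult_integral in He. lra.
Qed.

(** * Analyticity of quadratic polynomials *)

Lemma is_series_finite (a : nat -> R) (N : nat) :
  (forall n, (N < n)%nat -> a n = 0) -> is_series a (sum_n a N).
Proof.
  intros Ha. unfold is_series.
  apply filterlim_ext_loc with (fun _ => sum_n a N); [| apply filterlim_const].
  exists N. intros n Hn. induction Hn as [| n Hn IH]; [reflexivity |].
  rewrite sum_Sn, <- IH, Ha by lia. symmetry. apply Rplus_0_r.
Qed.

Lemma sum_n_zero_terms (a : nat -> R) (n : nat) :
  (forall k, (k <= n)%nat -> a k = 0) -> sum_n a n = 0.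
Proof.
  intros Ha. induction n as [| n IH]; [rewrite sum_O; now apply Ha |].
  rewrite sum_Sn, IH, Ha by auto. apply Rplus_0_r.
Qed.

Lemma analytic_at_ext (f g : plane -> R) (p : plane) :
  (forall q, f q = g q) -> analytic_at f p -> analytic_at g p.
Proof.
  intros Hfg [c [rho [Hrho H]]]. exists c, rho. split; [exact Hrho |].
  intros u v Hu Hv. rewrite <- Hfg. now apply H.
Qed.

(** Covers both the reversing involution, which is linear, and the first
    integral, which is a quadratic form. *)
Lemma analytic_at_quadratic (A B C D E G : R) (p : plane) :
  analytic_at (fun q => A * fst q ^ 2 + B * fst q * snd q + C * snd q ^ 2
                        + D * fst q + E * snd q + G) p.
Proof.
  destruct p as [x y].
  (* Taylor coefficients at p *)
  pose (c := fun k j => match k, j with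
    | 0%nat, 0%nat => A * x ^ 2 + B * x * y + C * y ^ 2 + D * x + E * y + G
    | 1%nat, 0%nat => 2 * A * x + B * y + D
    | 0%nat, 1%nat => B * x + 2 * C * y + E
    | 2%nat, 0%nat => A | 1%nat, 1%nat => B | 0%nat, 2%nat => C
    | _, _ => 0
    end).
  assert (Hc : forall k j, (2 < k + j)%nat -> c k j = 0)
    by (intros [|[|[|k]]] [|[|[|j]]]; simpl; solve [reflexivity | lia]).
  exists c, 1. split; [apply Rlt_0_1 |]. intros u v _ _. split.
  - eexists. apply (is_series_finite _ 2). intros n Hn.
    apply (sum_n_zero_terms). intros k Hk. rewrite Hc by lia.
    rewrite !Rmult_0_l. apply Rabs_R0.
  - evar_last.
    + apply (is_series_finite _ 2). intros n Hn.
      apply sum_n_zero_terms. intros k Hk. rewrite Hc by lia. ring.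
    + rewrite !sum_Sn, !sum_O. unfold plus; simpl. ring.
Qed.

(** * Reversibility and integrability of trace-free systems *)

(** A linear map reverses the linear field N exactly when it anticommutes with
    N.  For trace-free 2 by 2 matrices this is the single equation
    tr (sigma N) = 0; among the solutions with sigma^2 = Id, the upper
    triangular one with diagonal (1, - 1) has upper right entry - 2 n / c. *)
Lemma traceless_reversible (n b c : R) :
  c <> 0 -> reversible (system_I (0 + n) b c (0 - n)).
Proof.
  intros Hc. set (k := 2 * n / c).
  assert (Hk : k * c = 2 * n) by (unfold k; field; exact Hc).
  exists (fun _ => True), (fun q => (fst q - k * snd q, - snd q)).
  split; [apply open_true |]. split; [exact I |].
  split.
  { intros p _. split; simpl.
    - generalize (analytic_at_quadratic 0 0 0 1 (- k) 0 p).
      apply analytic_at_ext. intros q; ring.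
    - generalize (analytic_at_quadratic 0 0 0 0 (- 1) 0 p).
      apply analytic_at_ext. intros q; ring. }
  split.
  { intros [x y] _. split; [exact I |]. simpl. f_equal; ring. }
  split; [unfold origin; simpl; f_equal; ring |].
  split.
  { intros H. destruct (nbhd_origin_meets_rays _ 0 1 H) as [s [Hs E]].
    apply (f_equal snd) in E. simpl in E. lra. }
  split.
  { intros H. destruct (nbhd_origin_meets_rays _ 1 0 H) as [s [Hs E]].
    apply (f_equal fst) in E. unfold opp in E; simpl in E.
    unfold opp in E; simpl in E. lra. }
  intros [x y] _. unfold pull_back; simpl fst; simpl snd.
  replace (Derive (fun u => u - k * y) x) with 1
    by (symmetry; apply is_derive_unique; auto_derive; [trivial | ring]).
  replace (Derive (fun v => x - k * v) y) with (- k)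
    by (symmetry; apply is_derive_unique; auto_derive; [trivial | ring]).
  replace (Derive (fun _ => - y) x) with 0
    by (symmetry; apply is_derive_unique; auto_derive; [trivial | ring]).
  replace (Derive (fun v => - v) y) with (- 1)
    by (symmetry; apply is_derive_unique; auto_derive; [trivial | ring]).
  unfold system_I, opp; simpl. unfold prod_opp, opp; simpl.
  apply f_equal2.
  - replace n with (k * c / 2) by lra. field.
  - replace n with (k * c / 2) by lra. field.
Qed.

Lemma traceless_integrable (n b c : R) :
  c <> 0 -> analytically_integrable (system_I (0 + n) b c (0 - n)).
Proof.
  intros Hc. exists (fun _ => True), (areal_form n b c).
  split; [apply open_true |]. split; [exact I |].
  split.
  { intros p _. generalize (analytic_at_quadratic c (- (2 * n)) (- b) 0 0 0 p).
    apply analytic_at_ext. intros q. unfold areal_form. ring. }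
  split.
  { intros H. destruct (nbhd_origin_meets_rays _ 1 0 H) as [s [Hs E]].
    unfold areal_form, origin in E; simpl in E.
    assert (E' : c * (s * s) = 0) by lra.
    apply Rmult_integral in E'. destruct E' as [E' | E']; [now apply Hc | nra]. }
  intros gamma l r Hsol _.
  assert (Hd : forall t, l < t < r ->
    is_derive (fun u => areal_form n b c (gamma u)) t 0).
  { intros t Ht. evar_last; [apply (areal_derive 0), (Hsol t Ht) | simpl; ring]. }
  assert (Hlt : forall s t, l < s -> s < t -> t < r ->
    areal_form n b c (gamma s) = areal_form n b c (gamma t)).
  { intros s t Hs Hst Ht.
    apply (eq_is_derive (V := R_NormedModule) (fun u => areal_form n b c (gamma u)));
      [| exact Hst].
    intros u Hu. apply Hd; lra. }
  intros s t Hs Ht.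
  destruct (Rtotal_order s t) as [H | [-> | H]];
    [apply Hlt | reflexivity | symmetry; apply Hlt]; lra.
Qed.

Theorem theorem10 :
  (forall (a10 bt b01 : R) (t2 : nat), (1 < t2)%nat ->
     ~ monodromic (system_II a10 bt b01 t2)) /\
  (forall a10 a01 b10 b01 : R,
     (monodromic (system_I a10 a01 b10 b01) <->
        (b01 - a10) ^ 2 + 4 * b10 * a01 < 0) /\
     (monodromic (system_I a10 a01 b10 b01) ->
        (center (system_I a10 a01 b10 b01) <-> a10 = - b01))) /\
  (forall a10 a01 b10 b01 : R,
     center (system_I a10 a01 b10 b01) ->
     reversible (system_I a10 a01 b10 b01) /\
     analytically_integrable (system_I a10 a01 b10 b01)).
Proof.
  assert (Hneg : forall a b c d, monodromic (system_I a b c d) ->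
    (d - a) ^ 2 + 4 * c * b < 0).
  { intros a b c d H. apply Rnot_le_lt. intros Hdisc.
    destruct (system_I_invariant_line a b c d Hdisc)
      as [alpha [beta [lambda [Hab Hinv]]]].
    exact (invariant_line_not_monodromic _ alpha beta lambda Hab Hinv H). }
  split; [| split].
  - intros a10 bt b01 t2 _.
    apply (invariant_line_not_monodromic _ 1 0 a10); [left; lra |].
    intros p. unfold system_II; simpl. ring.
  - intros a b c d. split; [split; [apply Hneg |] |].
    + intros H. destruct (elliptic_normal_parameters a b c d H)
        as [mu [n [omega [Hom [E [-> ->]]]]]].
      destruct (Req_dec mu 0) as [-> | Hmu].
      * left. now apply elliptic_center with omega.
      * right. now apply elliptic_focus with omega.
    + intros H. destruct (elliptic_normal_parameters a b c d (Hneg _ _ _ _ H))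
        as [mu [n [omega [Hom [E [-> ->]]]]]].
      split; intros H'.
      * apply center_traceless with (omega := omega) in H'; [lra | assumption..].
      * replace mu with 0 by lra. now apply elliptic_center with omega.
  - intros a b c d H.
    destruct (elliptic_normal_parameters a b c d (Hneg _ _ _ _ (or_introl H)))
      as [mu [n [omega [Hom [E [-> ->]]]]]].
    assert (mu = 0) as -> by now apply center_traceless with (omega := omega) in H.
    assert (Hc : c <> 0) by (intros ->; nra).
    split; [now apply traceless_reversible | now apply traceless_integrable].
Qed.
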